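(* If $G$ is a tree with vertex cover number $\tau(G)$, then $\mathcal{E}(G)\geq 2\tau(G)$. Equality occurs if and only if $G$ is an edge (that is, $G\cong K_2$).
   Context: All graphs are finite, simple and undirected. The energy $\mathcal{E}(G)$ is the sum of the absolute values of all eigenvalues (with multiplicity) of the adjacency matrix $A(G)$. The vertex cover number $\tau(G)$ is the minimum cardinality of a set $X\subseteq V(G)$ such that every edge of $G$ has at least one endpoint in $X$. $K_2$ is the complete graph on 2 vertices.
   Formalization: The characterization of equality is stated only for trees with at least two vertices, because the one-vertex tree has energy 0 and vertex cover number 0, so equality holds there although it is not K_2; the inequality is stated for all trees. *)

(* Defs.v *)
From HB Require Import structures.
From mathcomp Require Import all_boot all_order all_algebra.

Set Implicit Arguments.
Unset Strict Implicit.
Unset Printing Implicit Defensive.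

Import Order.TTheory GRing.Theory Num.Theory.

Local Open Scope ring_scope.

Record sgraph := SGraph {
  vertex :> finType;
  adj : rel vertex;
  adj_sym : symmetric adj;
  adj_irrefl : irreflexive adj
}.

Definition graph_iso (G H : sgraph) : Prop :=
  exists2 f : G -> H, bijective f & forall x y : G, adj (f x) (f y) = adj x y.

Lemma complete_sym n : symmetric [rel x y : 'I_n | x != y].
Proof. by move=> x y /=; rewrite eq_sym. Qed.

Lemma complete_irrefl n : irreflexive [rel x y : 'I_n | x != y].
Proof. by move=> x /=; rewrite eqxx. Qed.

Definition complete_graph n : sgraph :=
  SGraph (@complete_sym n) (@complete_irrefl n).

Definition connected (G : sgraph) : Prop :=
  (0 < #|G|)%N /\ forall x y : G, connect (@adj G) x y.

(* [ucycle] also accepts the empty sequence and, because adjacency is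
   symmetric, [:: x; y] for an edge xy; neither is a cycle of the graph. *)
Definition acyclic (G : sgraph) : Prop :=
  forall c : seq G, ucycle (@adj G) c -> (size c < 3)%N.

Definition tree (G : sgraph) : Prop := connected G /\ acyclic G.

Definition vertex_cover (G : sgraph) (X : {set G}) : bool :=
  [forall x : G, forall y : G, adj x y ==> (x \in X) || (y \in X)].

Lemma vertex_coverT (G : sgraph) : vertex_cover [set: G].
Proof. by apply/forallP=> x; apply/forallP=> y; rewrite in_setT implybT. Qed.

Definition vertex_cover_number (G : sgraph) : nat :=
  #|[arg min_(X < [set: G] | vertex_cover X) #|X|]|.

Lemma vertex_cover_numberP (G : sgraph) :
  (exists2 X : {set G}, vertex_cover X & #|X| = vertex_cover_number G) /\
  (forall X : {set G}, vertex_cover X -> (vertex_cover_number G <= #|X|)%N).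
Proof.
rewrite /vertex_cover_number.
by case: arg_minnP => [|X coverX minX]; [exact: vertex_coverT|split; [exists X|]].
Qed.

Definition adjacency_matrix (R : pzSemiRingType) (G : sgraph) : 'M[R]_#|G| :=
  \matrix_(i, j) (adj (enum_val i) (enum_val j))%:R.

(* The eigenvalues of [A], repeated according to algebraic multiplicity. *)
Definition spectrum (C : closedFieldType) n (A : 'M[C]_n) : seq C :=
  sval (closed_field_poly_normal (char_poly A)).

Lemma spectrumP (C : closedFieldType) n (A : 'M[C]_n) :
  char_poly A = \prod_(z <- spectrum A) ('X - z%:P).
Proof.
rewrite /spectrum; case: closed_field_poly_normal => s /= {1}->.
by rewrite (monicP (char_poly_monic A)) scale1r.
Qed.

(* The ambient field is left abstract; the complex numbers [R[i]] over a real
   closed field [R], and [algC], are instances. *)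
Definition energy (C : numClosedFieldType) (G : sgraph) : C :=
  \sum_(z <- spectrum (adjacency_matrix C G)) `|z|.

(* Main.v *)
(** A is unitarily diagonalizable, so the energy is its trace norm and
    |tr (A U)| <= E(G) for every unitary U.  Take for U the permutation matrix of
    an involution s that moves every vertex to itself or to a neighbour, i.e. of
    a matching: tr (A U) is the number of vertices moved by s.  In a forest,
    matching a leaf with its neighbour and putting the neighbour in the cover
    shows inductively that some s moves at least 2 tau(G) vertices (Koenig).
    In the equality case A U is Hermitian, i.e. x ~ s y iff y ~ s x; then a
    second neighbour of a matched vertex would create a triangle or a 4-cycle,
    so a matched edge is a whole component of G. *)
Require Import Defs.
From HB Require Import structures.
From mathcomp Require Import all_boot all_order all_algebra fingroup perm.

Set Implicit Arguments.
Unset Strict Implicit.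
Unset Printing Implicit Defensive.

Import Order.TTheory GRing.Theory Num.Theory.

Local Open Scope ring_scope.
Local Open Scope sesquilinear_scope.

(** * Spectra of normal and unitary matrices *)

Lemma char_poly_conj (F : fieldType) n (P A : 'M[F]_n) : P \in unitmx ->
  char_poly (invmx P *m A *m P) = char_poly A.
Proof.
move=> Pu; rewrite /char_poly /char_poly_mx.
have -> : 'X%:M - map_mx polyC (invmx P *m A *m P) =
    map_mx polyC (invmx P) *m ('X%:M - map_mx polyC A) *m map_mx polyC P.
  rewrite mulmxBr mulmxBl !map_mxM; congr (_ - _).
  by rewrite mul_mx_scalar -scalemxAl -map_mxM mulVmx // map_mx1 scalemx1.
rewrite !det_mulmx mulrAC -det_mulmx -map_mxM mulVmx //.
by rewrite map_mx1 det1 mul1r.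
Qed.

(** By the spectral theorem A is similar to the diagonal matrix of [spectral_diag A], and a product
    of monic linear factors determines its roots with multiplicity. *)
Lemma spectral_diag_perm (C : numClosedFieldType) n (A : 'M[C]_n) :
  A \is normalmx ->
  perm_eq (spectrum A) [seq spectral_diag A 0 i | i : 'I_n].
Proof.
move=> /orthomx_spectralP A_eq.
have: char_poly A = \prod_(i < n) ('X - (spectral_diag A 0 i)%:P).
  rewrite [in LHS]A_eq char_poly_conj ?spectral_unit // char_poly_trig.
    by apply: eq_bigr => i _; rewrite mxE eqxx mulr1n.
  exact/diag_mx_is_trig.
rewrite spectrumP => spE; apply/prod_XsubC_eq.
by rewrite spE big_image.
Qed.

Lemma sum_norm_spectrum (C : numClosedFieldType) n (A : 'M[C]_n) :
  A \is normalmx ->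
  \sum_(z <- spectrum A) `|z| = \sum_i `|spectral_diag A 0 i|.
Proof.
by move=> /spectral_diag_perm spA; rewrite (perm_big _ spA) /= big_image.
Qed.

Lemma unitarymx_row_norm (C : numClosedFieldType) n (W : 'M[C]_n) i :
  W \is unitarymx -> \sum_j `|W i j| ^+ 2 = 1.
Proof.
move=> /unitarymxP /matrixP /(_ i i); rewrite !mxE eqxx mulr1n => <-.
by apply: eq_bigr => j _; rewrite !mxE normCK.
Qed.

Lemma unitarymx_le1 (C : numClosedFieldType) n (W : 'M[C]_n) i j :
  W \is unitarymx -> `|W i j| <= 1.
Proof.
move=> Wu; rewrite -(@expr_le1 _ 2) // -(unitarymx_row_norm i Wu).
by rewrite (bigD1 j) //= lerDl sumr_ge0 // => k _; rewrite exprn_ge0.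
Qed.

(** The diagonal entry already exhausts the norm of row i. *)
Lemma unitarymx_diag1 (C : numClosedFieldType) n (W : 'M[C]_n) i j :
  W \is unitarymx -> `|W i i| = 1 -> i != j -> W i j = 0.
Proof.
move=> Wu Wii ij; have := unitarymx_row_norm i Wu.
rewrite (bigD1 i) //= Wii expr1n -[RHS]addr0 => /addrI /psumr_eq0P W0.
apply/eqP; rewrite -normr_eq0 -sqrf_eq0 W0 //; last by rewrite eq_sym.
by move=> k _; rewrite exprn_ge0.
Qed.

(** * The trace bound and its equality case *)

Section TraceBound.
Variables (C : numClosedFieldType) (n : nat) (A U : 'M[C]_n).
Hypotheses (nA : A \is normalmx) (uU : U \is unitarymx).

Let P := spectralmx A.
Let d i := spectral_diag A 0 i.
(** U written in an orthonormal eigenbasis of A. *)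
Let W := P *m U *m invmx P.

Let uW : W \is unitarymx.
Proof.
rewrite /W invmx_unitary ?spectral_unitarymx //.
by rewrite !mul_unitarymx ?trmxC_unitary ?spectral_unitarymx.
Qed.

Let AU_conj : A *m U = invmx P *m (diag_mx (spectral_diag A) *m W) *m P.
Proof.
have /orthomx_spectralP A_eq := nA.
by rewrite {1}A_eq /W !mulmxA mulmxKV ?spectral_unit.
Qed.

Let trAU : \tr (A *m U) = \sum_i d i * W i i.
Proof.
rewrite AU_conj mxtrace_mulC mulKVmx ?spectral_unit //.
by apply: eq_bigr => i _; rewrite mul_diag_mx mxE.
Qed.

Let le_dW i : `|d i * W i i| <= `|d i|.
Proof. by rewrite normrM ler_piMr // unitarymx_le1. Qed.

(** In the eigenbasis the trace is the sum of the d_i W_ii, and the entries of a unitary matrix have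
    modulus at most 1. *)
Lemma norm_trace_le_sum_norm_spectrum :
  `|\tr (A *m U)| <= \sum_(z <- spectrum A) `|z|.
Proof.
rewrite sum_norm_spectrum // trAU (le_trans (ler_norm_sum _ _ _)) //.
exact: ler_sum.
Qed.

(* Equality in the triangle inequality forces d_i W_ii = |d_i|; rows of W having
   norm 1, diag(d) W is then the diagonal matrix of the |d_i|. *)
Lemma trace_eq_sum_norm_spectrum_hermitian :
  \tr (A *m U) = \sum_(z <- spectrum A) `|z| -> (A *m U)^t* = A *m U.
Proof.
rewrite sum_norm_spectrum // trAU => eq_tr.
have dW i : d i * W i i = `|d i|.
  exact: (normC_sum_upper (fun i _ => le_dW i) eq_tr).
have -> : A *m U = invmx P *m diag_mx (map_mx Num.norm (spectral_diag A)) *m P.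
  rewrite AU_conj; congr (_ *m _ *m _); apply/matrixP => i j.
  rewrite mul_diag_mx mxE [RHS]mxE; case: (eqVneq i j) => [<-|ij]; first by rewrite mulr1n [RHS]mxE dW.
  (* Row i vanishes if d_i = 0; otherwise |d_i| |W_ii| = |d_i| gives |W_ii| = 1, which kills the
     off-diagonal entries. *)
  rewrite mulr0n -/(d i); case: (eqVneq (d i) 0) => [->|di0].
    by rewrite mul0r.
  rewrite (unitarymx_diag1 uW) ?mulr0 //.
  apply: (@mulfI _ `|d i|); first by rewrite normr_eq0.
  by rewrite -normrM dW normr_id mulr1.
rewrite invmx_unitary ?spectral_unitarymx // !trmx_mul !map_mxM trmxCK.
rewrite tr_diag_mx map_diag_mx mulmxA; congr (_ *m diag_mx _ *m _).
by apply/rowP => i; rewrite 2!mxE; exact: conj_normC.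
Qed.

End TraceBound.

(** All eigenvalues have modulus 1: the diagonal form in an orthonormal eigenbasis is again unitary,
    so its rows have norm 1. *)
Lemma sum_norm_spectrum_unitary (C : numClosedFieldType) n (A : 'M[C]_n) :
  A \is normalmx -> A \is unitarymx -> \sum_(z <- spectrum A) `|z| = n%:R.
Proof.
move=> nA uA; rewrite sum_norm_spectrum // -[RHS]mulr_natl mulr1.
set P := spectralmx A; have Pu : P \is unitarymx by exact: spectral_unitarymx.
have /unitarymx_row_norm dU : diag_mx (spectral_diag A) \is unitarymx.
  have -> : diag_mx (spectral_diag A) = P *m A *m P^t*.
    have /orthomx_spectralP {2}-> := nA.
    by rewrite -invmx_unitary // !mulmxA mulmxV ?mul1mx ?mulmxK ?spectral_unit.
  by rewrite !mul_unitarymx ?trmxC_unitary.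
rewrite -[X in _ = X%:R]card_ord -sumr_const.
apply: eq_bigr => i _; apply/eqP; rewrite -(@eqrXn2 _ 2) // expr1n -(dU i).
rewrite (bigD1 i) //= big1 ?addr0 => [|j ji].
  by rewrite mxE eqxx mulr1n.
by rewrite mxE eq_sym (negPf ji) mulr0n normr0 expr0n.
Qed.

(** * Matchings and vertex covers in forests *)

(** The matching edges are the pairs {x, s x} with s x != x; fixed points are the unmatched
    vertices. *)
Definition matching_perm (G : sgraph) (s : {perm G}) : Prop :=
  involutive s /\ forall x, s x != x -> adj x (s x).

Section Forest.
Variables (G : sgraph) (acyclicG : acyclic G).
Implicit Types S : {set G}.
Local Open Scope nat_scope.

(** The path from x to z and the edge xz close a cycle, of length at least 3 because z comes after
    y. *)
Lemma acyclic_chord (x y z : G) (p : seq G) :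
  path (@adj G) x (y :: p) -> uniq [:: x, y & p] -> adj x z -> z \in p -> False.
Proof.
move=> xp xu xz zp; case/splitPr: zp xp xu => p1 p2 xp xu.
suff /acyclicG : ucycle (@adj G) [:: x, y & rcons p1 z].
  by rewrite /= size_rcons.
move: xp xu; rewrite -cat_rcons -2!cat_cons => xp xu.
apply/andP; split; last by move: xu; rewrite cat_uniq => /andP[].
by move: xp; rewrite /= cat_path => /and3P[-> py _]; rewrite rcons_path py last_rcons adj_sym.
Qed.

(* Otherwise every simple path inside S extends at its start to a longer one. *)
Lemma forest_leaf S (a b : G) : a \in S -> b \in S -> adj a b ->
  exists x y, [/\ x \in S, y \in S, adj x y &
    forall z, z \in S -> adj x z -> z = y].
Proof.
move=> aS bS ab.
pose leafless := [forall x in S, forall y in S, adj x y ==>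
   [exists z in S, adj x z && (z != y)]].
have [noleaf|] := boolP leafless; last first.
  case/forall_inPn => x xS /forall_inPn[y yS].
  rewrite negb_imply => /andP[xy /exists_inPn zxy].
  exists x, y; split=> // z zS xz; apply/eqP.
  by have := zxy z zS; rewrite xz negbK.
(* These paths have n + 2 distinct vertices, which is absurd for n = [#|G|]. *)
suff long n : exists x y p, [/\ size p = n, path (@adj G) x (y :: p),
    uniq [:: x, y & p] & {subset [:: x, y & p] <= S}].
  have [x [y [p [sp _ xu _]]]] := long #|G|.
  have := max_card (mem [:: x, y & p]).
  by rewrite (card_uniqP xu) /= sp ltnNge leqnSn.
elim: n => [|n [x [y [p [sp xp xu xS]]]]].
  exists a, b, [::]; split=> //=; first by rewrite ab.
    rewrite inE andbT; apply: contraTneq ab => ->.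
    by rewrite adj_irrefl.
  by move=> z; rewrite !inE => /orP[] /eqP->.
have xy : adj x y by case/andP: xp.
have xinS : x \in S by apply: xS; rewrite inE eqxx.
have yinS : y \in S by apply: xS; rewrite !inE eqxx orbT.
move/forall_inP/(_ x xinS)/forall_inP/(_ y yinS): noleaf.
rewrite xy => /exists_inP[z zS /andP[xz zy]].
(* z differs from x and y, and z in p would give a chord at x. *)
exists z, x, (y :: p); split; first by rewrite /= sp.
- by rewrite /= adj_sym xz.
- rewrite cons_uniq xu andbT 2!inE (negPf zy) /= negb_or.
  apply/andP; split.
    by apply: contraTneq xz => ->; rewrite adj_irrefl.
  by apply/negP; apply: acyclic_chord xp xu xz.
- by move=> t; rewrite inE => /predU1P[-> //|/xS].
Qed.

(** Relative to S, so that the induction can delete a leaf x of the subgraph induced on S together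
    with its neighbour y. As s moves only vertices of the set, the involution for the smaller set
    fixes x and y and can be composed with their transposition. *)
Lemma forest_konig_in S : exists (X : {set G}) (s : {perm G}),
  [/\ forall x y, x \in S -> y \in S -> adj x y -> (x \in X) || (y \in X),
      matching_perm s, forall x, s x != x -> x \in S &
      2 * #|X| <= #|[set x | s x != x]|].
Proof.
have [n] := ubnP #|S|; elim: n S => // n IHn S /ltnSE leSn.
have [/exists_inP[a aS /exists_inP[b bS ab]]|noedge] :=
  boolP [exists a in S, exists b in S, adj a b]; last first.
  exists set0, 1%g; split=> [x y xS yS xy||x|].
  - by case/existsP: noedge; exists x; rewrite xS; apply/exists_inP; exists y.
  - by split=> [x|x]; rewrite !perm1 ?eqxx.
  - by rewrite perm1 eqxx.
  - by rewrite cards0.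
have [x [y [xS yS xy leaf]]] := forest_leaf aS bS ab.
have neq_xy : x != y by apply: contraTneq xy => ->; rewrite adj_irrefl.
have [|X [s [cov [sK sadj] sS sX]]] := IHn (S :\: [set x; y]).
  apply: leq_trans leSn; apply: proper_card; rewrite properE subsetDl.
  by apply/subsetPn; exists x; rewrite // !inE eqxx.
have sx : s x = x.
  by apply/eqP/negP => /negP/sS; rewrite !inE eqxx.
have sy : s y = y.
  by apply/eqP/negP => /negP/sS; rewrite !inE eqxx orbT.
pose t := (tperm x y * s)%g.
have tx : t x = y by rewrite permM tpermL.
have ty : t y = x by rewrite permM tpermR.
have tD z : z != x -> z != y -> t z = s z.
  by move=> zx zy; rewrite permM tpermD // eq_sym.
exists (y |: X), t; split.
- move=> u v uS vS uv; rewrite !inE.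
  have [//|uy] := eqVneq u y; have [|vy] := eqVneq v y; first by rewrite orbT.
  have [ux|ux] := eqVneq u x.
    by case/eqP: vy; apply: leaf; rewrite // -ux.
  have [vx|vx] := eqVneq v x.
    by case/eqP: uy; apply: leaf; rewrite // -vx adj_sym.
  by apply: cov; rewrite // !inE negb_or ?ux ?uy ?vx ?vy.
- split=> z; have [->|zx] := eqVneq z x; rewrite ?tx ?ty //.
  + have [->|zy] := eqVneq z y; first by rewrite ty tx.
    rewrite tD // tD ?sK //; first by rewrite -sx (inj_eq perm_inj).
    by rewrite -sy (inj_eq perm_inj).
  + have [->|zy] := eqVneq z y; first by rewrite ty adj_sym.
    by rewrite tD //; apply: sadj.
- move=> z; have [->//|zx] := eqVneq z x; have [->//|zy] := eqVneq z y.
  by rewrite tD // => /sS; rewrite inE => /andP[].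
(* The moved set gains exactly x and y, while the cover gains at most the vertex y. *)
- have -> : [set z | t z != z] = x |: (y |: [set z | s z != z]).
    apply/setP => z; rewrite !inE.
    have [->|zx] := eqVneq z x; first by rewrite tx eq_sym.
    by have [->|zy] := eqVneq z y; rewrite ?ty ?tD.
  rewrite !cardsU1 !inE sx sy !eqxx (negPf neq_xy) /=.
  rewrite addnA mulnDr leq_add //.
  by case: (y \in X).
Qed.

Lemma forest_konig : exists2 s : {perm G}, matching_perm s &
  2 * vertex_cover_number G <= #|[set x | s x != x]|.
Proof.
have [X [s [cov sM _ sX]]] := forest_konig_in [set: G].
exists s => //; apply: leq_trans sX; rewrite leq_mul2l /=.
apply: (vertex_cover_numberP G).2.
by apply/forallP => x; apply/forallP => y; apply/implyP; apply: cov.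
Qed.

End Forest.

(** * Matchings tested against the adjacency matrix *)

Section MatchingPerm.
Variables (C : numClosedFieldType) (G : sgraph).
Local Notation A := (adjacency_matrix C G).

Lemma adjacency_matrix_sym : A^T = A.
Proof. by apply/matrixP => i j; rewrite !mxE adj_sym. Qed.

Lemma adjacency_matrix_conj : map_mx Num.conj A = A.
Proof. by apply/matrixP => i j; rewrite !mxE; exact: conjC_nat. Qed.

Lemma adjacency_matrix_normal : A \is normalmx.
Proof.
apply/normalmxP; rewrite adjacency_matrix_sym.
by rewrite adjacency_matrix_conj.
Qed.

Variables (s : {perm G}) (sM : matching_perm s).

Definition vertex_perm_mx : 'M[C]_#|G| :=
  \matrix_(i, j) (s (enum_val i) == enum_val j)%:R.

Lemma vertex_perm_mx_unitary : vertex_perm_mx \is unitarymx.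
Proof.
apply/unitarymxP/matrixP => i j; rewrite !mxE.
rewrite (bigD1 (enum_rank (s (enum_val i)))) //= big1 ?addr0 => [|k ki].
  rewrite !mxE enum_rankK eqxx mul1r (inj_eq perm_inj) (inj_eq enum_val_inj).
  by rewrite eq_sym; exact: conjC_nat.
rewrite !mxE; case: eqP => [sik|_]; last by rewrite mul0r.
by rewrite sik enum_valK eqxx in ki.
Qed.

(** The column of a vertex v in the permutation matrix has its only 1 in row s v, because s is its
    own inverse. *)
Lemma mul_adjacency_perm_mx i j :
  (A *m vertex_perm_mx) i j = (adj (enum_val i) (s (enum_val j)))%:R.
Proof.
have [sK _] := sM; rewrite mxE.
rewrite (bigD1 (enum_rank (s (enum_val j)))) //= big1 ?addr0 => [|k kj].
  by rewrite !mxE enum_rankK sK eqxx mulr1.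
rewrite !mxE; case: (_ =P enum_val j) => [skj|_]; last by rewrite mulr0.
by rewrite -skj sK enum_valK eqxx in kj.
Qed.

Lemma trace_adjacency_perm_mx :
  \tr (A *m vertex_perm_mx) = #|[set x | s x != x]|%:R.
Proof.
rewrite -[in RHS]sum1_card natr_sum big_mkcond.
rewrite [RHS](reindex _ (onW_bij _ (@enum_val_bij G))) /=.
apply: eq_bigr => i _; rewrite mul_adjacency_perm_mx inE.
have [-> /=|/(sM.2) ->//] := eqVneq; by rewrite adj_irrefl.
Qed.

Lemma matching_le_energy : #|[set x | s x != x]|%:R <= energy C G.
Proof.
rewrite -trace_adjacency_perm_mx -[X in X <= _]ger0_norm; last first.
  by rewrite trace_adjacency_perm_mx ler0n.
apply: norm_trace_le_sum_norm_spectrum vertex_perm_mx_unitary.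
exact: adjacency_matrix_normal.
Qed.

(* Equality makes A U symmetric, U being the permutation matrix of s. *)
Lemma matching_eq_energy : energy C G = #|[set x | s x != x]|%:R ->
  forall x y, adj x (s y) = adj y (s x).
Proof.
rewrite -trace_adjacency_perm_mx => eqE x y.
have := trace_eq_sum_norm_spectrum_hermitian adjacency_matrix_normal
  vertex_perm_mx_unitary (esym eqE).
move=> /matrixP /(_ (enum_rank y) (enum_rank x)); rewrite [LHS]mxE [in LHS]mxE.
rewrite !mul_adjacency_perm_mx !enum_rankK => /eqP.
have -> : (adj x (s y))%:R^* = (adj x (s y))%:R :> C by exact: conjC_nat.
by rewrite eqr_nat; case: (adj x _); case: (adj y _).
Qed.

End MatchingPerm.

(* A neighbour z of x other than s x would close a triangle (if z is fixed by s)
   or a 4-cycle x, z, s z, s x. *)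
Lemma matching_sym_neighbor (G : sgraph) (s : {perm G}) : acyclic G ->
  matching_perm s -> (forall x y, adj x (s y) = adj y (s x)) ->
  forall x z, s x != x -> adj x z -> z = s x.
Proof.
move=> acG [sK sadj] sym x z sx xz; apply/eqP/negPn/negP => zsx.
have xsx := sadj _ sx.
have zx : x != z by apply: contraTneq xz => ->; rewrite adj_irrefl.
(* The symmetry applied to z and s x carries the edge xz to an edge between s x and s z. *)
have szsx : adj (s x) (s z) by rewrite -sym sK adj_sym.
have [szz|szz] := eqVneq (s z) z.
  have /acG// : ucycle (@adj G) [:: x; z; s x].
  rewrite /ucycle /= xz -szz [adj (s z) _]adj_sym szsx [adj (s x) x]adj_sym.
  by rewrite xsx szz !inE !negb_or zx zsx eq_sym sx.
have /acG// : ucycle (@adj G) [:: x; z; s z; s x].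
rewrite /ucycle /= xz (sadj _ szz) [adj (s z) _]adj_sym szsx.
rewrite [adj (s x) x]adj_sym xsx !inE !negb_or zx zsx (inj_eq perm_inj).
rewrite [z == x]eq_sym zx [z == s z]eq_sym szz [x == s x]eq_sym sx /= !andbT.
by apply: contra_neq zsx => ->; rewrite sK.
Qed.

(** * Recognizing K_2, its cover number and its energy *)

(** A path starting at x can only alternate between x and y. *)
Lemma connected_edge_closed (G : sgraph) (x y : G) : connected G -> x != y ->
  (forall z, adj x z -> z = y) -> (forall z, adj y z -> z = x) ->
  forall z, (z == x) || (z == y).
Proof.
move=> [_ conG] xy nx ny z; have /connectP[p xp ->] := conG x z.
elim/last_ind: p xp => [|p w IHp]; first by rewrite eqxx.
rewrite rcons_path last_rcons => /andP[/IHp pxy].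
by case/orP: pxy => /eqP-> => [/nx|/ny] ->; rewrite eqxx ?orbT.
Qed.

Lemma edge_iso_K2 (G : sgraph) (x y : G) : adj x y ->
  (forall z, (z == x) || (z == y)) -> graph_iso G (complete_graph 2).
Proof.
move=> xy Gxy.
have neq_xy : x != y by apply: contraTneq xy => ->; rewrite adj_irrefl.
have neq_yx : y != x by rewrite eq_sym.
exists (fun z => if z == x then ord0 else ord_max).
  exists (fun i : 'I_2 => if i == ord0 then x else y).
    by move=> z; have /orP[/eqP->|/eqP->] := Gxy z; rewrite ?eqxx ?(negPf neq_yx).
  by case=> [[|[|//]] lt_i] /=; rewrite ?eqxx ?(negPf neq_yx); apply: val_inj.
move=> u v /=; have /orP[/eqP->|/eqP->] := Gxy u; have /orP[/eqP->|/eqP->] := Gxy v;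
  by rewrite ?eqxx ?(negPf neq_yx) ?adj_irrefl ?xy // adj_sym xy.
Qed.

Lemma vertex_cover_number_gt0 (G : sgraph) (x y : G) : adj x y ->
  (0 < vertex_cover_number G)%N.
Proof.
have [[X covX <-] _] := vertex_cover_numberP G => xy.
have /forallP/(_ x)/forallP/(_ y) := covX; rewrite xy /= card_gt0.
by move=> /orP[] Xv; apply/set0Pn; eexists; exact: Xv.
Qed.

Lemma K2_edge (G : sgraph) : graph_iso G (complete_graph 2) ->
  exists x y : G, [/\ adj x y, x != y & forall z, (z == x) || (z == y)].
Proof.
case=> f [g fK gK] fadj; exists (g ord0), (g ord_max).
have adjg : adj (g ord0) (g ord_max) by rewrite -fadj !gK.
split=> //; first by apply: contraTneq adjg => ->; rewrite adj_irrefl.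
move=> z; rewrite -(fK z) !(inj_eq (can_inj gK)).
by case: (f z) => [[|[|//]] lt_i].
Qed.

Lemma vertex_cover_number_K2 (G : sgraph) : graph_iso G (complete_graph 2) ->
  vertex_cover_number G = 1%N.
Proof.
move=> /K2_edge[x [y [xy _ Gxy]]]; apply/eqP.
rewrite eqn_leq (vertex_cover_number_gt0 xy) andbT -(cards1 x).
apply: (vertex_cover_numberP G).2; apply/forallP => u; apply/forallP => v.
rewrite !inE; apply/implyP; have /orP[->//|/eqP->] := Gxy u.
by have /orP[->|/eqP->] := Gxy v; rewrite ?orbT // adj_irrefl.
Qed.

(** The adjacency matrix is the permutation matrix of the transposition of the two vertices, hence
    unitary, so the energy is the order of G. *)
Lemma energy_K2 (C : numClosedFieldType) (G : sgraph) :
  graph_iso G (complete_graph 2) -> energy C G = 2.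
Proof.
move=> isoG; have [x [y [xy neq_xy Gxy]]] := K2_edge isoG.
have neq_yx : y != x by rewrite eq_sym.
have cardG : #|G| = 2.
  rewrite -cardsT (_ : [set: G] = [set x; y]) ?cards2 ?neq_xy //.
  by apply/setP => z; rewrite !inE Gxy.
have -> : 2 = #|G|%:R :> C by rewrite cardG.
apply: sum_norm_spectrum_unitary; first exact: adjacency_matrix_normal.
suff -> : adjacency_matrix C G = vertex_perm_mx C (tperm x y).
  exact: vertex_perm_mx_unitary.
apply/matrixP => i j; rewrite !mxE; congr (_%:R : C).
have /orP[/eqP->|/eqP->] := Gxy (enum_val i); rewrite ?tpermL ?tpermR;
by have /orP[/eqP->|/eqP->] := Gxy (enum_val j);
  rewrite ?eqxx ?adj_irrefl ?(negPf neq_xy) ?(negPf neq_yx) // ?xy // adj_sym xy.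
Qed.

(* The one-vertex tree has energy 0 = 2 * 0, so the characterization of
   equality is about trees having at least one edge. *)
Theorem theorem3p1 (C : numClosedFieldType) (G : sgraph) (treeG : tree G) :
  2 * (vertex_cover_number G)%:R <= energy C G /\
  ((1 < #|G|)%N ->
   (energy C G = 2 * (vertex_cover_number G)%:R <->
    graph_iso G (complete_graph 2))).
Proof.
have [conG acG] := treeG; have [s sM] := forest_konig acG.
rewrite -(ler_nat C) natrM => tau_le.
have le_energy := matching_le_energy C sM.
split=> [|G_gt1]; first exact: le_trans tau_le le_energy.
split=> [eqE|isoG]; last by rewrite energy_K2 // vertex_cover_number_K2 // mulr1.
(* The number of moved vertices is squeezed between 2 tau(G) and the energy. *)
have eq_card : energy C G = #|[set x | s x != x]|%:R.
  by apply/le_anti; rewrite le_energy {1}eqE tau_le.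
have sym := matching_eq_energy sM eq_card.
have nbr := matching_sym_neighbor acG sM sym.
(* A connected graph on at least two vertices has an edge, so tau(G) > 0 and the matching is
   nonempty. *)
have [x sx] : exists x, s x != x.
  have [a [b ab]] : exists a b : G, adj a b.
    have /card_gt1P[a [b [_ _ neq_ab]]] := G_gt1.
    have /connectP[[|c p] /= ap b_last] := conG.2 a b.
      by rewrite b_last eqxx in neq_ab.
    by exists a, c; case/andP: ap.
  have /card_gt0P[x] : (0 < #|[set x | s x != x]|)%N.
    rewrite -(ltr_nat C) -eq_card eqE -natrM ltr_nat muln_gt0.
    exact: vertex_cover_number_gt0 ab.
  by rewrite inE; exists x.
have ssx : s (s x) != s x by rewrite (inj_eq perm_inj).
(* By [nbr] at x and at s x, each is the only neighbour of the other. *)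
apply: (edge_iso_K2 (sM.2 _ sx)); apply: connected_edge_closed => //.
- by rewrite eq_sym.
- by move=> z; apply: nbr.
- by move=> z /(nbr _ _ ssx) ->; rewrite (sM.1 x).
Qed.
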